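(* Let $n \ge k \ge 1$ be integers and $s_1,\ldots,s_n \in (0,1]$, $S = \sum_i s_i$. Consider the procedure: if $S < k$, set $p_i = s_i + (k-S)/n$ and then, while some $p_i > 1$, add $(p_i-1)/|\{j : p_j < 1\}|$ to every $p_j < 1$ and set $p_i = 1$ (so that at the end $p_i \in [0,1]$ and $\sum_i p_i = k$); if $S \ge k$, set $p_i = s_i \cdot k/S$. Then select a cohort of exactly $k$ candidates by a dependent rounding procedure that includes candidate $i$ with probability exactly $p_i$. This procedure outputs a cohort of $k$ candidates with marginal selection probabilities $p_1,\ldots,p_n$ satisfying $|p_i - p_j| \le |s_i - s_j|$ for all $i,j$, and $$\min_i \frac{p_i}{s_i} = \max\Big\{\min_i \frac{q_i}{s_i} \;:\; q\in[0,1]^n,\ \sum_i q_i = k,\ |q_i - q_j| \le |s_i - s_j|\ \forall i,j\Big\}.$$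
   Context: The ratio utility of a cohort selection with marginal probabilities $p_i$ for scores $s_i$ is $\min_i p_i/s_i$. A fairness-preserving selection is one whose marginals satisfy $|p_i - p_j| \le |s_i - s_j|$ for all $i,j$. *)

(* Defs.v *)
From mathcomp Require Import all_boot all_order all_algebra.
From mathcomp Require Import classical_sets reals.

Set Implicit Arguments.
Unset Strict Implicit.
Unset Printing Implicit Defensive.

Import Order.TTheory GRing.Theory Num.Theory.
Local Open Scope ring_scope.

Section CohortSelection.
Variables (R : realType) (n : nat).
Implicit Types (s p q : 'I_n -> R) (k : nat).

(* The minimum over a nonempty index set: the fold is seeded with one of the
   values f i0, so no neutral element enters; the value 0 is only taken for
   n = 0. *)
Definition fmin (f : 'I_n -> R) : R :=
  if [pick i : 'I_n] is Some i0 then \big[Num.min/f i0]_(i < n) f i else 0.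

Definition ratio_utility s p : R := fmin (fun i => p i / s i).

Definition fairness_preserving s p : Prop :=
  forall i j, `|p i - p j| <= `|s i - s j|.

Definition marginal_vector k p : Prop :=
  (forall i, 0 <= p i <= 1) /\ \sum_(i < n) p i = k%:R.

Definition is_max (A : set R) (m : R) : Prop := A m /\ ubound A m.

(* One iteration of the loop at a chosen i with p i > 1. All tests p j < 1
   and the cardinality refer to the values before the iteration; candidates
   with p j >= 1 other than i are left untouched. *)
Definition cap_at (i : 'I_n) p : 'I_n -> R := fun j =>
  if j == i then 1
  else if p j < 1 then p j + (p i - 1) / #|[set l | p l < 1]|%:R
  else p j.

(* The choice of i is left unspecified, so the loop is nondeterministic. *)
Definition cap_step p p' : Prop := exists2 i, 1 < p i & p' = cap_at i p.

Inductive cap_loop : ('I_n -> R) -> ('I_n -> R) -> Prop :=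
| cap_loop_exit p : (forall i, p i <= 1) -> cap_loop p p
| cap_loop_iter p p' q : cap_step p p' -> cap_loop p' q -> cap_loop p q.

Definition shifted_scores k s : 'I_n -> R :=
  fun i => s i + (k%:R - \sum_(j < n) s j) / n%:R.

Definition scaled_scores k s : 'I_n -> R :=
  fun i => s i * (k%:R / \sum_(j < n) s j).

(* Some execution of the first phase ends with the vector p. *)
Definition computes_marginals k s p : Prop :=
  if \sum_(j < n) s j < k%:R then cap_loop (shifted_scores k s) p
  else p = scaled_scores k s.

(* No execution of the first phase runs forever: accessibility for the
   converse of cap_step says that there is no infinite chain of iterations. *)
Definition marginals_terminate k s : Prop :=
  \sum_(j < n) s j < k%:R ->
  Acc (fun p' p => cap_step p p') (shifted_scores k s).

(* D is the probability mass function of a random cohort. *)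
Definition cohort_selection k (D : {ffun {set 'I_n} -> R}) : Prop :=
  [/\ forall C, 0 <= D C,
      \sum_(C : {set 'I_n}) D C = 1
    & forall C, D C != 0 -> #|C| = k].

Definition marginal (D : {ffun {set 'I_n} -> R}) : 'I_n -> R :=
  fun i => \sum_(C : {set 'I_n} | i \in C) D C.

(* D is a possible output distribution of a dependent rounding of p. *)
Definition dependent_rounding k p (D : {ffun {set 'I_n} -> R}) : Prop :=
  cohort_selection k D /\ forall i, marginal D i = p i.

Definition feasible_marginals k s : set ('I_n -> R) :=
  [set q | marginal_vector k q /\ fairness_preserving s q]%classic.

End CohortSelection.

(* Main.v *)
(** In the case [S < k] every iterate [p] of the loop satisfies
    [min(p_i, 1) = min(s_i + t, 1)] for one level [t >= 0], so the final vector
    is [p_i = min(s_i + t, 1)], which is 1-Lipschitz in the scores.  The ratio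
    [p_i / s_i] is then smallest at a largest score [s_m]; either [p_m = 1], or
    no coordinate is capped and a feasible [q] with [q_m > p_m] would exceed [p]
    everywhere, contradicting [\sum q = k].  In the case [S >= k] the ratio is
    constantly [k / S], the weighted mean of the ratios [q_i / s_i].

    A rounding exists for every marginal vector because a fractional vector has
    two fractional entries, and moving mass between them in either direction
    until one becomes integral writes it as a convex combination of two vectors
    with fewer fractional entries. *)
Require Import Defs.
From mathcomp Require Import all_boot all_order all_algebra.
From mathcomp Require Import boolp classical_sets reals.
From mathcomp Require Import ring lra.
Set Implicit Arguments.
Unset Strict Implicit.
Unset Printing Implicit Defensive.

Import Order.TTheory GRing.Theory Num.Theory.
Local Open Scope ring_scope.

(** * Minimum over a finite index set *)

Section Minimum.
Variables (R : realType) (n : nat).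
Implicit Types f : 'I_n -> R.

Lemma fmin_le f i : fmin f <= f i.
Proof.
rewrite /fmin; case: pickP => [i0 _|/(_ i)//].
exact: bigmin_le_cond.
Qed.

(** The index [i] witnesses [0 < n]: for [n = 0] the value of [fmin] is the default 0, which [x] may
    exceed. *)
Lemma le_fmin f (i : 'I_n) x : (forall j, x <= f j) -> x <= fmin f.
Proof.
move=> xf; rewrite /fmin; case: pickP => [i0 _|/(_ i)//].
by apply: le_bigmin => // j _; apply: xf.
Qed.

End Minimum.

(** * Existence of a dependent rounding *)

Section Rounding.
Variables (R : realType) (n : nat).
Implicit Types (p q : 'I_n -> R) (k : nat).

Definition roundable k p := exists D, dependent_rounding k p D.

(** Draw the cohort from [D] with probability [u] and from [E] otherwise; marginals are linear in
    the distribution. *)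
Lemma roundable_convex k p q u : 0 <= u <= 1 ->
  roundable k p -> roundable k q ->
  roundable k (fun i => u * p i + (1 - u) * q i).
Proof.
move=> /andP[u0 u1] [D [[D0 D1 Dk] Dp]] [E [[E0 E1 Ek] Eq]].
exists [ffun C => u * D C + (1 - u) * E C]; split; first split.
- move=> C; rewrite ffunE; apply: addr_ge0; apply: mulr_ge0 => //.
  by rewrite subr_ge0.
- under eq_bigr do rewrite ffunE.
  by rewrite big_split /= -!mulr_sumr D1 E1; ring.
- move=> C; rewrite ffunE => nz; apply/eqP; apply: contraNT nz => Ck.
  have /eqP -> : D C == 0 by apply: contraNT Ck => /Dk ->.
  have /eqP -> : E C == 0 by apply: contraNT Ck => /Ek ->.
  by rewrite !mulr0 addr0.
- move=> i; rewrite /marginal; under eq_bigr do rewrite ffunE.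
  by rewrite big_split /= -!mulr_sumr -Dp -Eq.
Qed.

Lemma roundable_indicator (C : {set 'I_n}) :
  roundable #|C| (fun i => (i \in C)%:R).
Proof.
exists [ffun B => (B == C)%:R]; split; first split.
- by move=> B; rewrite ffunE ler0n.
- rewrite (bigD1 C) //= ffunE eqxx big1 ?addr0 // => B /negPf BC.
  by rewrite ffunE BC.
- by move=> B; rewrite ffunE; case: (B =P C) => [->//|_]; rewrite eqxx.
- move=> i; rewrite /marginal big_mkcond (bigD1 C) //= ffunE eqxx.
  rewrite big1 ?addr0; first by case: (i \in C).
  by move=> B /negPf BC; rewrite ffunE BC if_same.
Qed.

Definition fractional p : {set 'I_n} := [set i | 0 < p i < 1].

Lemma integral_entry k p i : marginal_vector k p -> i \notin fractional p ->
  p i = (p i == 1)%:R.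
Proof.
move=> [/(_ i) /andP[p0 p1] _]; rewrite inE.
case: (p i =P 1) => [-> //|/eqP pn1].
by rewrite lt_neqAle eq_sym p0 andbT lt_neqAle p1 pn1 !andbT negbK => /eqP.
Qed.

(** If [i] were the only fractional entry, the others would sum to a natural number [m], and [k]
    would lie strictly between [m] and [m + 1]. *)
Lemma second_fractional k p i : marginal_vector k p -> i \in fractional p ->
  exists2 j, j != i & j \in fractional p.
Proof.
move=> pk; have [_ sumk] := pk => iF.
case: (pickP [pred j | (j != i) && (j \in fractional p)]) => [j /andP[ji jF]|none].
  by exists j.
exfalso; move: sumk; rewrite (bigD1 i) //=.
rewrite (eq_bigr (fun j => (nat_of_bool (p j == 1))%:R)); last first.
  move=> j ji; apply: (integral_entry pk).
  by have := none j; rewrite /= ji /= => ->.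
rewrite -natr_sum; set m := (\sum_(_ < _ | _) _)%N => pik.
move: iF; rewrite inE => /andP[p0 p1].
have : m%:R < k%:R :> R by lra.
have : k%:R < m.+1%:R :> R by rewrite -natr1; lra.
by rewrite !ltr_nat ltnS => km /(leq_ltn_trans km); rewrite ltnn.
Qed.

Definition transfer p i j e : 'I_n -> R :=
  fun l => if l == i then p i + e else if l == j then p j - e else p l.

(** The largest mass that can move from [j] to [i] while both entries stay in [[0, 1]]. *)
Definition max_transfer p i j : R := Num.min (1 - p i) (p j).

Lemma sum_transfer p i j e : i != j ->
  \sum_l transfer p i j e l = \sum_l p l.
Proof.
move=> ij; have ji : j != i by rewrite eq_sym.
rewrite (bigD1 i) // (bigD1 j) //= [RHS](bigD1 i) //= [in RHS](bigD1 j) //=.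
rewrite /transfer eqxx (negPf ji) eqxx.
rewrite (eq_bigr p); first by ring.
by move=> l /andP[/negPf -> /negPf ->].
Qed.

Lemma max_transfer_marginal k p i j : i != j -> marginal_vector k p ->
  marginal_vector k (transfer p i j (max_transfer p i j)).
Proof.
move=> ij [p01 sumk]; split; last by rewrite sum_transfer.
have /andP[pi0 pi1] := p01 i; have /andP[pj0 pj1] := p01 j.
have e1 : max_transfer p i j <= 1 - p i by rewrite ge_min lexx.
have e2 : max_transfer p i j <= p j by rewrite ge_min lexx orbT.
have e0 : 0 <= max_transfer p i j by rewrite le_min pj0 subr_ge0 pi1.
by move=> l; rewrite /transfer; case: ifP => _; [|case: ifP => _ //]; lra.
Qed.

(** Integral entries are untouched, and the transfer stops when entry [i] reaches 1 or entry [j]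
    reaches 0. *)
Lemma max_transfer_fractional p i j : i != j ->
  i \in fractional p -> j \in fractional p ->
  (#|fractional (transfer p i j (max_transfer p i j))| < #|fractional p|)%N.
Proof.
move=> ij iF jF; have /negPf ji : j != i by rewrite eq_sym.
apply: proper_card; apply/properP; split.
  apply/fintype.subsetP => l; rewrite inE /transfer.
  by case: (l =P i) => [->//|_]; case: (l =P j) => [->//|_]; rewrite inE.
case: (leP (1 - p i) (p j)) => h.
  exists i => //; rewrite inE /transfer eqxx /max_transfer min_l //.
  by rewrite addrC subrK ltxx andbF.
exists j => //; rewrite inE /transfer eqxx ji /max_transfer min_r ?(ltW h) //.
by rewrite subrr ltxx.
Qed.

(** With weights [b / (a + b)] and [a / (a + b)] the displacements [a] and [- b] of entry [i]
    cancel, and likewise at [j]. *)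
Lemma transfer_convex p i j a b : i != j -> 0 < a -> 0 < b ->
  p = (fun l => b / (a + b) * transfer p i j a l +
                (1 - b / (a + b)) * transfer p j i b l).
Proof.
move=> ij a0 b0; apply/funext => l; rewrite /transfer.
have ab : a + b != 0 by rewrite gt_eqF ?addr_gt0.
case: (l =P i) => [->|_]; first by rewrite (negPf ij); field.
by case: (l =P j) => [->|_]; field.
Qed.

Lemma marginal_vector_roundable k p : marginal_vector k p -> roundable k p.
Proof.
have [m] := ubnP #|fractional p|; elim: m p => // m IHm p; rewrite ltnS => pm pk.
have [F0|[i iF]] := set_0Vmem (fractional p).
  (* Without fractional entries [p] is the indicator of a set, which has size [k] because the
     entries sum to [k]. *)
  have pE l : p l = (p l == 1)%:R by apply: (integral_entry pk); rewrite F0 inE.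
  have pC : p = (fun l => (l \in [set l | p l == 1])%:R).
    by apply/funext => l; rewrite inE -pE.
  have -> : k = #|[set l | p l == 1]|.
    apply/eqP; rewrite -(eqr_nat R) -(proj2 pk) -sum1_card natr_sum.
    rewrite [X in _ == X]big_mkcond; apply/eqP; apply: eq_bigr => l _.
    by rewrite {1}pE inE; case: eqP.
  by rewrite {2}pC; apply: roundable_indicator.
have [j ji jF] := second_fractional pk iF; have ij : i != j by rewrite eq_sym.
have pos x y : x \in fractional p -> y \in fractional p -> 0 < max_transfer p x y.
  by rewrite !inE lt_min subr_gt0 => /andP[_ ->] /andP[->].
have step x y : x != y -> x \in fractional p -> y \in fractional p ->
    roundable k (transfer p x y (max_transfer p x y)).
  move=> xy xF yF; apply: IHm; last exact: max_transfer_marginal.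
  exact: leq_trans (max_transfer_fractional xy xF yF) pm.
have a0 := pos _ _ iF jF; have b0 := pos _ _ jF iF.
rewrite (transfer_convex p ij a0 b0); apply: roundable_convex; try exact: step.
have ab : 0 < max_transfer p i j + max_transfer p j i by rewrite addr_gt0.
apply/andP; split; first by rewrite divr_ge0 // ltW.
by rewrite ler_pdivrMr // mul1r lerDr ltW.
Qed.

End Rounding.

(** * Termination and invariant of the capping loop *)

Section Loop.
Variables (R : realType) (n : nat).
Implicit Types (s p q : 'I_n -> R) (k : nat).

(** Each iteration lowers the number of entries different from 1: entry [i] becomes 1, and entries
    equal to 1 are left alone. *)
Lemma cap_step_Acc p : Acc (fun p' p => cap_step p p') p.
Proof.
have [m] := ubnP #|[set j | p j != 1]|; elim: m p => [p|m IHm p].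
  (* [done] would apply the constructor of [Acc] forever. *)
  by rewrite ltn0; discriminate.
rewrite ltnS => pm; constructor => _ [i pi1 ->]; apply: IHm.
apply: leq_trans pm; apply: proper_card; apply/properP; split.
  apply/fintype.subsetP => j; rewrite !inE /cap_at.
  case: (j =P i) => [_|_]; first by rewrite /= eqxx.
  by case: ifP => // pj1 _; rewrite lt_eqF.
by exists i; rewrite inE; [rewrite gt_eqF|rewrite /cap_at eqxx eqxx].
Qed.

Lemma cap_loop_exists p : exists q, cap_loop p q.
Proof.
elim: (cap_step_Acc p) => {}p _ IHp.
have [i pi1|p1] := pickP (fun i => 1 < p i).
  have pp' : cap_step p (cap_at i p) by exists i.
  by have [q p'q] := IHp _ pp'; exists q; apply: cap_loop_iter p'q.
by exists p; constructor => i; rewrite leNgt p1.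
Qed.

(** Keeps the divisor in [cap_at] nonzero: were no entry below 1, the entry [p i > 1] would push the
    sum above [n]. *)
Lemma card_below_gt0 p i : \sum_j p j <= n%:R -> 1 < p i ->
  (0 < #|[set j | (p j < 1)%R]|)%N.
Proof.
move=> sump pi1; rewrite card_gt0; apply: contraTneq sump => none.
have p1 j : 1 <= p j by have := finset.in_set0 j; rewrite -none inE leNgt => ->.
rewrite -ltNge -[n in n%:R]card_ord -sum1_card natr_sum.
rewrite (bigD1 i) //= [ltRHS](bigD1 i) //=.
by apply: ltr_leD => //; apply: ler_sum.
Qed.

Lemma sum_cap_at p i : \sum_j p j <= n%:R -> 1 < p i ->
  \sum_j cap_at i p j = \sum_j p j.
Proof.
move=> sump pi1; have := card_below_gt0 sump pi1.
rewrite /cap_at; set m := #|_| => m0.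
have m_neq0 : m%:R != 0 :> R by rewrite pnatr_eq0 -lt0n.
transitivity (\sum_j (p j + ((if j == i then 1 - p i else 0) +
    (if p j < 1 then (p i - 1) / m%:R else 0)))).
  apply: eq_bigr => j _; case: (j =P i) => [->|_].
    by rewrite ltNge (ltW pi1) /=; ring.
  by case: ifP => _; rewrite ?add0r ?addr0.
rewrite !big_split /= -!big_mkcond big_pred1_eq /= sumr_const.
have -> : #|[pred j | p j < 1]| = m by apply: eq_card => j; rewrite !inE.
by rewrite -[_ *+ m]mulr_natr divfK //; ring.
Qed.

Definition capped_shift s t : 'I_n -> R := fun i => Num.min (s i + t) 1.

(** All entries below 1 rise by the same [d], so the level becomes [t + d]. Truncation at 1 hides
    the excess of entries not yet processed, so the choice of [i] does not matter. *)
Lemma capped_shift_cap_at s t p i : 0 <= t -> 1 < p i ->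
  (forall j, Num.min (p j) 1 = capped_shift s t j) ->
  exists2 t', 0 <= t' &
    forall j, Num.min (cap_at i p j) 1 = capped_shift s t' j.
Proof.
move=> t0 pi1 pst; rewrite /cap_at; set d := (p i - 1) / _.
have d0 : 0 <= d by rewrite divr_ge0 // subr_ge0 ltW.
exists (t + d); first exact: addr_ge0.
(* Here [s j + t >= 1] already, so the cap still binds at the higher level. *)
have capped j : 1 <= p j -> 1 = capped_shift s (t + d) j.
  move=> pj1; have := pst j; rewrite /capped_shift (min_r pj1).
  by case: (leP (s j + t) 1) => h e; rewrite min_r //; lra.
move=> j; case: (j =P i) => [->|_]; first by rewrite minxx -capped // ltW.
case: ltP => [pj1|pj1]; last by rewrite min_r // -capped.
have := pst j; rewrite /capped_shift (min_l (ltW pj1)).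
by case: (leP (s j + t) 1) => [_ ->|_ e]; [rewrite addrA|lra].
Qed.

(** On exit every entry is at most 1, so the truncation on the left of the invariant disappears. *)
Lemma cap_loop_capped_shift s t p q : 0 <= t -> \sum_j p j <= n%:R ->
  (forall j, Num.min (p j) 1 = capped_shift s t j) -> cap_loop p q ->
  \sum_j q j = \sum_j p j /\ exists2 t', 0 <= t' & q = capped_shift s t'.
Proof.
move=> t0 sump pst pq; elim: pq t t0 sump pst => {p q} [p p1|p p' q].
  move=> t t0 _ pst; split=> //; exists t => //.
  by apply/funext => j; rewrite -pst min_l.
move=> [i pi1 ->] _ IH t t0 sump pst.
have [t' t'0 pst'] := capped_shift_cap_at t0 pi1 pst.
by have := IH _ t'0; rewrite sum_cap_at //; apply.
Qed.

End Loop.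

(** * Feasibility and optimality of the marginals *)

Section Optimality.
Variables (R : realType) (n : nat) (s : 'I_n -> R).
Hypothesis s01 : forall i, 0 < s i <= 1.
Implicit Types (p q : 'I_n -> R) (k : nat).

Lemma capped_shift_fair t : fairness_preserving s (capped_shift s t).
Proof.
move=> i j; rewrite /capped_shift.
have := ler_norm (s i - s j); have := ler_norm (s j - s i).
rewrite distrC => h1 h2.
case: (leP (s i + t) 1) => hi; case: (leP (s j + t) 1) => hj;
  by rewrite ler_norml; apply/andP; split; lra.
Qed.

Lemma capped_shift_feasible k t : 0 <= t -> \sum_i capped_shift s t i = k%:R ->
  feasible_marginals k s (capped_shift s t).
Proof.
move=> t0 sumk; split; last exact: capped_shift_fair.
split=> // i; have /andP[si0 _] := s01 i.
by rewrite le_min ge_min lexx orbT ler01 addr_ge0 // ltW.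
Qed.

Lemma capped_shift_optimal k t q : 0 <= t ->
  \sum_i capped_shift s t i = k%:R -> feasible_marginals k s q -> (0 < n)%N ->
  ratio_utility s q <= ratio_utility s (capped_shift s t).
Proof.
move=> t0 sumk [[q01 sumq] qfair] n0; set p := capped_shift s t in sumk *.
have [m _ sm] := arg_maxP s (erefl : xpredT (Ordinal n0)).
have sle i : s i <= s m by apply: sm.
have qm : q m <= p m.
  rewrite leNgt; apply/negP => pqm.
  have smt : s m + t < 1.
    rewrite ltNge; apply/negP => h; have /andP[_] := q01 m.
    by rewrite leNgt -[X in X < _](min_r h) pqm.
  have : \sum_i p i < \sum_i q i.
    apply: ltr_sum => [|i _].
      by apply/hasP; exists m => //; rewrite mem_index_enum.
    (* Fairness gives [q i >= q m - (s m - s i)], and [q m > s m + t]. *)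
    apply: le_lt_trans (_ : s i + t < _); first by rewrite ge_min lexx.
    have := le_trans (ler_norm _) (qfair m i).
    rewrite [`|s m - _|]ger0_norm ?subr_ge0 //.
    by move: pqm; rewrite /p /capped_shift min_l ?(ltW smt) //; lra.
  by rewrite sumk sumq ltxx.
(* For [x > 0] the quotient [min(x + t, 1) / x] is nonincreasing in [x], so
   [q m / s m <= p m / s m <= p i / s i] for every [i]. *)
apply: (@le_trans _ _ (q m / s m)); first exact: fmin_le.
apply: (le_fmin m) => i.
have /andP[si0 si1] := s01 i; have /andP[sm0 _] := s01 m; have smi := sle i.
rewrite ler_pdivrMr // mulrAC ler_pdivlMr //.
apply: le_trans (ler_wpM2r (ltW si0) qm) _; rewrite /p /capped_shift.
by case: (leP (s i + t) 1) => hi; case: (leP (s m + t) 1) => hm; nra.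
Qed.

Lemma scaled_scores_feasible k : \sum_i s i >= k%:R -> 0 < \sum_i s i ->
  feasible_marginals k s (scaled_scores k s).
Proof.
move=> kS S0; rewrite /scaled_scores; set c := _ / _.
have c0 : 0 <= c by rewrite divr_ge0 // ltW.
(* A factor of at most 1 keeps the scores in [[0, 1]] and shrinks their differences. *)
have c1 : c <= 1 by rewrite ler_pdivrMr // mul1r.
split; first split.
- move=> i; have /andP[si0 si1] := s01 i.
  by rewrite mulr_ge0 ?(ltW si0) //= mulr_ile1 // ltW.
- by rewrite -mulr_suml mulrC divfK ?gt_eqF.
- by move=> i j; rewrite -mulrBl normrM (ger0_norm c0) ler_piMr.
Qed.

Lemma scaled_scores_optimal k q : \sum_i q i = k%:R -> 0 < \sum_i s i ->
  (0 < n)%N ->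
  ratio_utility s q <= ratio_utility s (scaled_scores k s).
Proof.
move=> sumq S0 n0; apply: (le_fmin (Ordinal n0)) => i.
have /andP[si0 _] := s01 i.
rewrite /scaled_scores mulrAC divff ?gt_eqF // mul1r ler_pdivlMr // -sumq mulr_sumr.
(* With [r] the ratio utility of [q], the bounds [r * s j <= q j] add up to [r * S <= k]. *)
apply: ler_sum => j _; have /andP[sj0 _] := s01 j.
by rewrite -ler_pdivlMr //; apply: fmin_le.
Qed.

Lemma computes_marginals_optimal k p : (0 < k <= n)%N ->
  computes_marginals k s p ->
  feasible_marginals k s p /\
  forall q, feasible_marginals k s q -> ratio_utility s q <= ratio_utility s p.
Proof.
move=> /andP[k0 kn]; have n0 := leq_trans k0 kn; rewrite /computes_marginals.
have nR0 : n%:R != 0 :> R by rewrite pnatr_eq0 -lt0n.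
case: ltP => [Sk|kS].
  have sum_shifted : \sum_i shifted_scores k s i = k%:R.
    rewrite /shifted_scores big_split /= sumr_const card_ord.
    by rewrite -[_ *+ n]mulr_natr divfK //; ring.
  (* The loop starts from the scores shifted by this level, so the invariant holds initially by
     definition. *)
  move=> /(cap_loop_capped_shift (s := s)
      (t := (k%:R - \sum_(j < n) s j) / n%:R)); case=> //.
  - by rewrite divr_ge0 // subr_ge0 ltW.
  - by rewrite sum_shifted ler_nat.
  rewrite sum_shifted => sump [t t0 pE]; rewrite pE in sump *.
  split; first exact: capped_shift_feasible.
  by move=> q qF; apply: capped_shift_optimal qF n0.
move=> ->; have S0 : 0 < \sum_i s i by apply: lt_le_trans kS; rewrite ltr0n.
split; first exact: scaled_scores_feasible.
by move=> q [[_ sumq] _]; apply: scaled_scores_optimal.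
Qed.

End Optimality.

Theorem theorem3 (R : realType) (n k : nat) (s : 'I_n -> R)
    (hk : (1 <= k)%N) (hkn : (k <= n)%N) (hs : forall i, 0 < s i <= 1) :
  marginals_terminate k s /\
  (exists p, computes_marginals k s p) /\
  (forall p, computes_marginals k s p ->
     marginal_vector k p /\
     (exists D, dependent_rounding k p D) /\
     (forall D, dependent_rounding k p D ->
        fairness_preserving s (marginal D) /\
        is_max [set ratio_utility s q | q in feasible_marginals k s]%classic
          (ratio_utility s (marginal D)))).
Proof.
split; first by move=> _; apply: cap_step_Acc.
split.
  rewrite /computes_marginals; case: ltP => _; last by eexists.
  exact: cap_loop_exists.
move=> p /computes_marginals_optimal [] //; first by rewrite hk.
move=> [pk pfair] pmax; split=> //; split.
  exact: marginal_vector_roundable.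
move=> D [_ Dp]; have -> : marginal D = p by apply/funext.
by split=> //; split=> [|_ [q qF <-]]; [exists p|apply: pmax].
Qed.
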